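(* Let $\alpha \in [\frac{1}{2},1)$ and let $G$ be a minimally 2-edge-connected graph of order $n$. (i) If $n \geq 7$ is odd, then $\rho_{\alpha}(G)\leq \rho_{\alpha}(F_{\frac{n-1}{2}})$, with equality if and only if $G\cong F_{\frac{n-1}{2}}$. (ii) If $n \geq 8$ is even, then $\rho_{\alpha}(G)\leq\rho_{\alpha}(K_{2,n-2})$, with equality if and only if $G\cong K_{2,n-2}$.
   Context: All graphs are simple, finite and undirected. For a graph $G$ with adjacency matrix $A(G)$ and diagonal degree matrix $D(G)$, and real $\alpha\in[0,1]$, define $A_\alpha(G)=\alpha D(G)+(1-\alpha)A(G)$; its largest eigenvalue $\rho_\alpha(G)$ is called the $\alpha$-index of $G$. A graph is $k$-edge-connected if removing fewer than $k$ edges always leaves a connected graph; it is minimally $k$-edge-connected if it is $k$-edge-connected and deleting any edge leaves a graph that is not $k$-edge-connected. For $k\geq 1$, $F_k$ denotes the graph on $2k+1$ vertices consisting of $k$ triangles sharing exactly one common vertex (i.e. $K_1\vee kK_2$). $K_{2,n-2}$ is the complete bipartite graph with parts of sizes $2$ and $n-2$. *)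

(* Defs.v *)
From HB Require Import structures.
From mathcomp Require Import all_boot all_order all_algebra.
From mathcomp Require Import boolp classical_sets reals.
From mathcomp Require Import polyrcf complex.

Set Implicit Arguments.
Unset Strict Implicit.
Unset Printing Implicit Defensive.

Import Order.TTheory GRing.Theory Num.Theory.
Local Open Scope ring_scope.

Record sgraph := SGraph {
  vertex :> finType;
  adj : rel vertex;
  adj_sym : symmetric adj;
  adj_irr : irreflexive adj }.

Definition edges (G : sgraph) : {set {set G}} :=
  [set [set p.1; p.2] | p : G * G & adj p.1 p.2].

Section DeleteEdges.
Variables (G : sgraph) (S : {set {set G}}).

Definition del_adj : rel G :=
  fun x y => adj x y && ([set x; y]%SET \notin S).

Lemma del_adj_sym : symmetric del_adj.
Proof. by move=> x y; rewrite /del_adj adj_sym finset.setUC. Qed.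

Lemma del_adj_irr : irreflexive del_adj.
Proof. by move=> x; rewrite /del_adj adj_irr. Qed.

Definition del_edges : sgraph := SGraph del_adj_sym del_adj_irr.
End DeleteEdges.

Definition connected_graph (G : sgraph) : Prop :=
  (0 < #|G|)%N /\ forall x y : G, connect (@adj G) x y.

Definition edge_connected (k : nat) (G : sgraph) : Prop :=
  forall S : {set {set G}},
    S \subset edges G -> (#|S| < k)%N -> connected_graph (del_edges S).

Definition minimally_edge_connected (k : nat) (G : sgraph) : Prop :=
  edge_connected k G /\
  forall e : {set G}, e \in edges G ->
    ~ edge_connected k (del_edges [set e]%SET).

Definition graph_iso (G H : sgraph) : Prop :=
  exists2 f : G -> H, bijective f & forall x y, adj (f x) (f y) = adj x y.

Definition degree (G : sgraph) (x : G) : nat := #|[set y | adj x y]%SET|.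

Section AlphaIndex.
Variable R : realType.

(* Rows and columns follow the enumeration of the vertices of G. *)
Definition adjacency_mx (G : sgraph) : 'M[R]_#|G| :=
  \matrix_(i, j) (adj (enum_val i) (enum_val j))%:R.

Definition degree_mx (G : sgraph) : 'M[R]_#|G| :=
  diag_mx (\row_i (degree (enum_val i))%:R).

Definition alpha_mx (alpha : R) (G : sgraph) : 'M[R]_#|G| :=
  alpha *: degree_mx G + (1 - alpha) *: adjacency_mx G.

(* The set of eigenvalues is finite, and nonempty as soon as G has a vertex,
   so this supremum is a maximum: see alpha_index_max. *)
Definition alpha_index (alpha : R) (G : sgraph) : R :=
  sup [set r | eigenvalue (alpha_mx alpha G) r]%classic.

Lemma alpha_mx_sym alpha G : (alpha_mx alpha G)^T = alpha_mx alpha G.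
Proof.
rewrite /alpha_mx linearD !linearZ /= /degree_mx tr_diag_mx; congr (_ + _ *: _).
by apply/matrixP=> i j; rewrite !mxE adj_sym.
Qed.

Lemma sqr_row_ge0 n (x : 'rV[R]_n) : 0 <= (x *m x^T) 0 0.
Proof. by rewrite mxE sumr_ge0 // => i _; rewrite mxE -expr2 sqr_ge0. Qed.

Lemma sqr_row_eq0 n (x : 'rV[R]_n) : (x *m x^T) 0 0 = 0 -> x = 0.
Proof.
move=> x0; apply/rowP=> j; rewrite mxE; apply/eqP; rewrite -sqrf_eq0.
move: x0; rewrite mxE => /eqP; rewrite psumr_eq0 => [/allP/(_ j)|i _].
  by rewrite mem_index_enum mxE -expr2 => /(_ isT).
by rewrite mxE -expr2 sqr_ge0.
Qed.

Lemma sym_eigenvalue n (A : 'M[R]_n) :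
  (0 < n)%N -> A^T = A -> exists r, eigenvalue A r.
Proof.
move=> n0 symA; pose AC : 'M[R[i]]_n := map_mx (real_complex R) A.
have /closed_rootP[z] : size (char_poly AC) != 1.
  by rewrite size_char_poly eqSS -lt0n.
rewrite -eigenvalue_root_char => /eigenvalueP[v vA v0].
pose x : 'rV[R]_n := \row_j complex.Re (v 0 j); pose y : 'rV[R]_n := \row_j complex.Im (v 0 j).
case: z vA => a b vA.
have eqv j : \sum_k v 0 k * (A k j)%:C%C = (a +i* b)%C * v 0 j.
  by have /rowP/(_ j) := vA; rewrite !mxE => <-; apply: eq_bigr => k _; rewrite mxE.
have xA : x *m A = a *: x - b *: y.
  apply/rowP=> j; have := congr1 (@complex.Re R) (eqv j); rewrite raddf_sum !mxE.
  case: (v 0 j) => c d /= <-; apply: eq_bigr => k _.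
  by rewrite mxE; case: (v 0 k) => p q /=; rewrite mulr0 subr0.
have yA : y *m A = a *: y + b *: x.
  apply/rowP=> j; have := congr1 (@complex.Im R) (eqv j); rewrite raddf_sum !mxE.
  case: (v 0 j) => c d /= <-; apply: eq_bigr => k _.
  by rewrite mxE; case: (v 0 k) => p q /=; rewrite mulr0 add0r.
have xy0 : x = 0 -> y = 0 -> v = 0.
  move=> /rowP x0 /rowP y0; apply/rowP=> j.
  by have := x0 j; have := y0 j; rewrite !mxE; case: (v 0 j) => c d /= -> ->.
have b0 : b = 0.
  have E : (x *m A *m y^T) 0 0 = (y *m A *m x^T) 0 0.
    by rewrite -[y *m A *m x^T]trmxK [RHS]mxE !trmx_mul trmxK symA mulmxA.
  have yx : (y *m x^T) 0 0 = (x *m y^T) 0 0.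
    by rewrite -[y *m x^T]trmxK [LHS]mxE trmx_mul trmxK.
  move: E; rewrite xA yA mulmxBl mulmxDl -!scalemxAl.
  have e3 m (M N : 'M[R]_m) i j : (M + N) i j = M i j + N i j by rewrite mxE.
  have e4 m (N : 'M[R]_m) i j : (- N) i j = - N i j by rewrite mxE.
  have e5 m c (N : 'M[R]_m) i j : (c *: N) i j = c * N i j by rewrite mxE.
  rewrite !(e3, e4, e5) yx => /addrI /eqP; rewrite eq_sym -subr_eq0 opprK -mulrDr.
  rewrite mulf_eq0 => /orP[/eqP //|].
  rewrite paddr_eq0 ?sqr_row_ge0 // => /andP[/eqP/sqr_row_eq0 x0 /eqP/sqr_row_eq0 y0].
  by rewrite xy0 ?eqxx in v0.
rewrite b0 !scale0r subr0 addr0 in xA yA.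
exists a; apply/eigenvalueP; have [x0|x0] := eqVneq x 0; last by exists x.
by exists y => //; apply: contraNneq v0 => /(xy0 x0) ->.
Qed.

Lemma alpha_index_max alpha (G : sgraph) : (0 < #|G|)%N ->
  eigenvalue (alpha_mx alpha G) (alpha_index alpha G) /\
  forall r, eigenvalue (alpha_mx alpha G) r -> r <= alpha_index alpha G.
Proof.
move=> G0; set A := alpha_mx alpha G.
have [r0 r0A] := sym_eigenvalue G0 (alpha_mx_sym alpha G).
have p0 : char_poly A != 0 by rewrite -size_poly_eq0 size_char_poly.
have [s sP] : exists s : seq R, forall r, eigenvalue A r = (r \in s).
  exists (rootsR (char_poly A)) => r.
  by rewrite eigenvalue_root_char -(roots_on_rootsR p0 r) ?inE.
have [m mA mmax] : exists2 m, eigenvalue A m & forall r, eigenvalue A r -> r <= m.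
  exists (\big[Num.max/r0]_(r <- s) r) => [|r]; last first.
    rewrite sP; elim: s {sP} => // h t IH.
    rewrite big_cons inE le_max => /predU1P[->|/IH->]; first by rewrite lexx.
    by rewrite orbT.
  rewrite big_seq; elim/big_ind: _ => // [x y|i]; last by rewrite sP.
  by rewrite /Num.max; case: ifP.
suff -> : alpha_index alpha G = m by [].
apply/eqP; rewrite eq_le; apply/andP; split.
  by apply: ge_sup; [exists m | move=> r /= /mmax].
by apply: ub_le_sup; [exists m => r /= /mmax | ].
Qed.

End AlphaIndex.

Section Friendship.
Variable k : nat.

(* None is the common vertex; the i-th triangle is completed by
   Some (i, false) and Some (i, true). *)
Definition friendship_adj : rel (option ('I_k * bool)) := fun x y =>
  match x, y with
  | None, None => false
  | Some p, Some q => (p.1 == q.1) && (p.2 != q.2)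
  | _, _ => true
  end.

Lemma friendship_adj_sym : symmetric friendship_adj.
Proof. by move=> [p|] [q|] //=; rewrite eq_sym [p.2 == _]eq_sym. Qed.

Lemma friendship_adj_irr : irreflexive friendship_adj.
Proof. by move=> [p|] //=; rewrite !eqxx. Qed.

Definition friendship : sgraph := SGraph friendship_adj_sym friendship_adj_irr.
End Friendship.

Section CompleteBipartite.
Variables a b : nat.

Definition bipartite_adj : rel ('I_a + 'I_b) := fun x y =>
  match x, y with
  | inl _, inr _ | inr _, inl _ => true
  | _, _ => false
  end.

Lemma bipartite_adj_sym : symmetric bipartite_adj.
Proof. by move=> [x|x] [y|y]. Qed.

Lemma bipartite_adj_irr : irreflexive bipartite_adj.
Proof. by move=> [x|x]. Qed.

Definition complete_bipartite : sgraph :=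
  SGraph bipartite_adj_sym bipartite_adj_irr.
End CompleteBipartite.

(* Main.v *)
(* In a minimally 2-edge-connected graph G of order n no cycle has a chord.
   Counting codegrees around a vertex v of degree at most n - 2, this forces
   the degrees of the neighbours of v to sum to at most 2 (n - 2). The degree
   vector y is then a Collatz-Wielandt test vector: A_alpha y < l y for an
   explicit eigenvalue l of the extremal graph, hence rho_alpha(G) < l. The
   exceptions are a vertex of degree n - 1, which forces G to be a friendship
   graph, and (n even) a vertex v of degree n - 2: then G is a K_{2,s} and some
   triangles glued at v, and the eigenvector of K_{2,n-2} for l is the test
   vector. *)
Require Import Defs.
From mathcomp Require Import all_boot all_order all_algebra.
From mathcomp Require Import reals.
From mathcomp Require Import zify ring lra.
Set Implicit Arguments.
Unset Strict Implicit.
Unset Printing Implicit Defensive.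
Import Order.TTheory GRing.Theory Num.Theory.

(** * Chords of cycles in 2-edge-connected and minimally 2-edge-connected graphs *)

Section EdgeConnectivity.
Variable G : sgraph.
Implicit Types (x y u v w : G).

Definition neighbors x : {set G} := [set y | adj x y].

Definition codegree v w : nat := #|neighbors v :&: neighbors w|.

Lemma edge_mem x y : ([set x; y] \in edges G) = adj x y.
Proof.
apply/imsetP/idP => [[[a b]]|xy]; last by exists (x, y); rewrite ?inE.
rewrite inE /= => ab E.
have abN : a != b by apply: contraTneq ab => ->; rewrite adj_irr.
have := set21 a b; have := set22 a b; rewrite -E !inE.
case/orP=> /eqP bE /orP[] /eqP aE; rewrite aE bE ?eqxx // in ab abN.
by rewrite adj_sym.
Qed.

Lemma two_edge_connected_connect x y :
  edge_connected 2 G -> connect (@adj G) x y.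
Proof.
move=> /(_ set0); rewrite sub0set cards0 => /(_ isT isT) [_ /(_ x y)].
by apply: connect_sub => a b /= /andP[ab _]; exact: connect1.
Qed.

(** Deleting all edges at [x] isolates it, so there must be at least two of them. *)
Lemma min_degree_ge2 x : edge_connected 2 G -> 1 < #|G| -> 1 < degree x.
Proof.
move=> con2 G2; rewrite ltnNge; apply/negP => dx.
pose S := [set [set x; y] | y in neighbors x].
have [||_ conS] := con2 S.
- by apply/subsetP=> _ /imsetP[y + ->]; rewrite inE edge_mem.
- by apply: leq_ltn_trans (leq_imset_card _ _) _; rewrite ltnS.
have [y yx] : exists y, y != x.
  have : 0 < #|predC1 x| by rewrite cardC1; lia.
  by case/card_gt0P=> y; exists y.
have /connectP[[|z p] /=] := conS x y; first by move=> _ E; rewrite E eqxx in yx.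
case/andP=> /andP[xz /negP[]]; apply: imset_f; by rewrite inE.
Qed.

Hypothesis minG : minimally_edge_connected 2 G.

(** Only the first step can touch [x], and that step ends in [p], not at [y]. *)
Lemma path_avoid_edge (p : seq G) x y : p != [::] -> uniq (x :: y :: p) ->
  path (@adj G) x (rcons p y) ->
  path (fun a b => adj a b && ([set a; b] != [set x; y])) x (rcons p y).
Proof.
case: p => // a p _ /= /and3P[]; rewrite !inE !negb_or => /and3P[xy xa xp].
case/andP=> ya yp /andP[ap up] /andP[-> pth] /=; apply/andP; split.
  apply: contraNneq xa => /setP/(_ a); rewrite !inE eqxx orbT => /esym.
  by rewrite [a == y]eq_sym (negPf ya) orbF eq_sym.
apply: (@sub_in_path _ (fun z => z != x)) pth; last first.
  apply/allP=> z; rewrite inE mem_rcons inE.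
  case/or3P=> [/eqP->|/eqP->|zp]; [by rewrite eq_sym|by rewrite eq_sym|].
  by apply: contraNneq xp => <-.
move=> b c; rewrite !unfold_in => bx cx bc; rewrite bc /=.
apply: contraNneq bx => /setP/(_ x); rewrite !inE eqxx /= => /orP[] /eqP E.
  by rewrite E.
by rewrite E eqxx in cx.
Qed.

(* The two arcs [p] and [q] of the cycle between the ends of the chord [xy]
   share no edge, so one of them replaces [xy] after any further deletion. *)
Lemma chord_free (p q : seq G) x y : adj x y -> p != [::] -> q != [::] ->
  uniq (x :: y :: p ++ q) ->
  path (@adj G) x (rcons p y) -> path (@adj G) x (rcons q y) -> False.
Proof.
move=> xy p0 q0 upq pp pq; have [con2 nocon] := minG.
apply: (nocon [set x; y]); first by rewrite edge_mem.
move=> S subS S2.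
have SG : S \subset edges G.
  apply: subset_trans subS _; apply/subsetP => _ /imsetP[[a b] + ->].
  by rewrite inE => /andP[ab _]; rewrite edge_mem.
have [G0 conS] := con2 S SG S2; split=> // a0 b0.
set e := @adj _; have esym : connect_sym e by apply: sym_connect_sym; exact: adj_sym.
(* [G] without [S] is connected, so the only step that may need replacing is the edge [xy]
   itself. *)
suff Exy : connect e x y.
  move: (conS a0 b0); apply: connect_sub => a b /= /andP[ab abS].
  have [E|abxy] := eqVneq [set a; b] [set x; y]; last first.
    by apply: connect1; rewrite /e /= /del_adj /= /del_adj ab inE abxy.
  have := set21 a b; have := set22 a b; rewrite E !inE.
  case/orP=> /eqP-> /orP[] /eqP->; rewrite ?connect0 // ?Exy //.
  by rewrite esym.
have go (r : seq G) : r != [::] -> uniq (x :: y :: r) ->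
    path (@adj G) x (rcons r y) ->
    (forall a b, a \in x :: y :: r -> b \in x :: y :: r ->
      [set a; b] != [set x; y] -> [set a; b] \notin S) -> connect e x y.
  move=> r0 ur pr notS; apply/connectP; exists (rcons r y); last by rewrite last_rcons.
  have := path_avoid_edge r0 ur pr.
  apply: (@sub_in_path _ (fun z => z \in x :: y :: r)); last first.
    by apply/allP=> z; rewrite !inE mem_rcons inE.
  move=> a b ar br /andP[ab abxy].
  by rewrite /e /= /del_adj /= /del_adj ab inE abxy notS.
have [up uq disj] : [/\ uniq (x :: y :: p), uniq (x :: y :: q) &
    forall z, z \in p -> z \in q -> False].
  move: upq; rewrite /= !inE !mem_cat cat_uniq !negb_or.
  case/and3P=> /and3P[-> -> ->] /andP[-> ->] /and3P[-> /hasPn dq ->]; split=> //.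
  by move=> z zp /dq /=; rewrite zp.
(* If no edge of [S] other than [xy] has both ends on the arc [p], that arc works. Otherwise this
   edge is the whole of [S]; if it also had both ends on [q], they would lie in [[set x; y]], so the
   arc [q] works. The final [true] only pads the conjunction for [and5P]. *)
have [/existsP[a /existsP[b /and5P[ap bp ab1 ab2 ab3]]]|] :=
  boolP [exists a, exists b, [&& a \in x :: y :: p, b \in x :: y :: p,
    [set a; b] != [set x; y], [set a; b] \in S & true]]; last first.
  rewrite negb_exists => /forallP np; apply: (go p) => // a b ap bp ab.
  have := np a; rewrite negb_exists => /forallP/(_ b).
  by rewrite ap bp ab andbT.
apply: (go q) => // c d cq dq cd; apply/negP => cdS.
have E : [set c; d] = [set a; b].
  by have /card_le1_eqP := S2; apply.
have [cp dp] : c \in x :: y :: p /\ d \in x :: y :: p.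
  by have := set21 c d; have := set22 c d; rewrite E !in_set2;
    case/orP=> /eqP-> /orP[] /eqP->.
have xory z : z \in x :: y :: p -> z \in x :: y :: q -> z \in [set x; y].
  rewrite !inE; case: (z == x); case: (z == y) => //= zp zq.
  by case: (disj z).
case/negP: cd; rewrite eqEcard subUset !sub1set !xory //= !cards2.
case: (eqVneq c d) => [cdE|_]; last by case: (x == y).
by have := subsetP SG _ cdS; rewrite cdE edge_mem adj_irr.
Qed.

Lemma adj_neq x y : adj x y -> x != y.
Proof. by apply: contraTneq => ->; rewrite adj_irr. Qed.

Local Ltac solve_neqs :=
  rewrite /= ?inE ?negb_or; repeat (apply/andP; split);
  by [| rewrite eq_sym].

(** The number in [chord4], [chord5] and [chord6] is the length of the cycle that has [xy] as a
    chord. *)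
Lemma chord4 x y a b : adj x y -> adj x a -> adj a y -> adj x b -> adj b y ->
  a != b -> False.
Proof.
move=> xy xa ay xb yb ab; apply: (@chord_free [:: a] [:: b] x y) => //=.
- move: (adj_neq xy) (adj_neq xa) (adj_neq ay) (adj_neq xb) (adj_neq yb) => *.
  solve_neqs.
- by rewrite xa ay.
- by rewrite xb yb.
Qed.

Lemma chord5 x y a b c : adj x y -> adj x a -> adj a y ->
  adj x b -> adj b c -> adj c y ->
  a != b -> a != c -> c != x -> b != y -> False.
Proof.
move=> xy xa ay xb bc cy *; apply: (@chord_free [:: a] [:: b; c] x y) => //=.
- move: (adj_neq xy) (adj_neq xa) (adj_neq ay) (adj_neq xb) (adj_neq bc).
  by move: (adj_neq cy) => *; solve_neqs.
- by rewrite xa ay.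
- by rewrite xb bc cy.
Qed.

Lemma chord6 x y a b c d : adj x y -> adj x a -> adj a b -> adj b y ->
  adj x c -> adj c d -> adj d y ->
  a != y -> b != x -> c != y -> d != x ->
  a != c -> a != d -> b != c -> b != d -> False.
Proof.
move=> xy xa ab yb xc cd dy *.
apply: (@chord_free [:: a; b] [:: c; d] x y) => //=.
- move: (adj_neq xy) (adj_neq xa) (adj_neq ab) (adj_neq yb) (adj_neq xc).
  by move: (adj_neq cd) (adj_neq dy) => *; solve_neqs.
- by rewrite xa ab yb.
- by rewrite xc cd dy.
Qed.

Lemma exists_in_neq (A : {set G}) x : 1 < #|A| -> exists2 a, a \in A & a != x.
Proof.
case/card_gt1P=> a [b [aA bA ab]].
have [E|] := eqVneq a x; last by exists a.
by exists b => //; rewrite -E eq_sym.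
Qed.

Lemma exists_in_neq2 (A : {set G}) x y :
  2 < #|A| -> exists a, [/\ a \in A, a != x & a != y].
Proof.
move=> A3; have [|a] := @exists_in_neq (A :\ x) y.
  by have := cardsD1 x A; case: (x \in A); lia.
by rewrite !inE => /andP[ax aA] ay; exists a.
Qed.

(** Double counting of the walks [v u w] that end in [A], by endpoint and by midpoint. *)
Lemma sum_codegree v (A : {set G}) :
  \sum_(w in A) codegree v w = \sum_(u in neighbors v) #|neighbors u :&: A|.
Proof.
under eq_bigr do rewrite /codegree -sum1_card.
under [RHS]eq_bigr do rewrite -sum1_card.
rewrite (exchange_big_dep (mem (neighbors v))) /=; last first.
  by move=> w u _; rewrite inE => /andP[].
apply: eq_bigr => u uv; apply: eq_bigl => w.
by rewrite !inE [adj w u]adj_sym andbC; rewrite inE in uv; rewrite uv.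
Qed.

(** * Codegrees around a vertex, and the structure of [G] at degree n - 1 or n - 2 *)

Section AroundVertex.
Variable v : G.
Local Notation N := (neighbors v).
Local Notation R := (~: (v |: N)).
Local Notation B := [set w in R | 2 < codegree v w].

Lemma card_nonneighbors : #|R| = #|G| - 1 - degree v.
Proof. by rewrite cardsCs setCK cardsU1 inE adj_irr subnDA. Qed.

(** Two such neighbours [w1] and [w2] of [u] would make [vu] a chord of a cycle: of length 4 if both
    lie in [N], 5 if one lies in [B], 6 if both do. A vertex of [B] is joined to [v] through a
    common neighbour, and having three of them leaves one that avoids [u] and the rest of the
    cycle. *)
Lemma card_neighbors_in_neighborhood_le1 u : u \in N -> #|neighbors u :&: (N :|: B)| <= 1.
Proof.
rewrite inE => vu; rewrite leqNgt; apply/negP => /card_gt1P[w1 [w2 []]].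
have NB w1' w2' : adj u w1' -> adj u w2' -> adj v w1' -> w2' \in B -> False.
  rewrite !inE negb_or => uw1 uw2 vw1 /andP[/andP[w2v vw2] c2].
  have [b []] := exists_in_neq2 u w1' c2; rewrite !inE => /andP[vb w2b] bu bw1.
  apply: (@chord5 v u w1' b w2') => //; first [by rewrite eq_sym | by rewrite adj_sym | idtac].
  by apply: contraNneq vw2 => <-.
rewrite !in_setI !in_setU => /andP[uw1 w1A] /andP[uw2 w2A] w12.
rewrite !in_set in uw1 uw2.
case/orP: w1A => w1A; case/orP: w2A => w2A.
- by rewrite !in_set in w1A w2A; apply: (@chord4 v u w1 w2) => //; rewrite adj_sym.
- by rewrite in_set in w1A; exact: NB uw1 uw2 w1A w2A.
- by rewrite in_set in w2A; exact: NB uw2 uw1 w2A w1A.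
move: w1A w2A; rewrite !inE !negb_or => /andP[/andP[w1v vw1] c1].
case/andP=> /andP[w2v vw2] c2.
have [a] := exists_in_neq u (ltnW c1); rewrite !inE => /andP[va w1a] au.
have [b [+ bu ba]] := exists_in_neq2 u a c2; rewrite !inE => /andP[vb w2b].
apply: (@chord6 v u a w1 b w2) => //; first [by rewrite eq_sym | by rewrite adj_sym | idtac].
  by apply: contraNneq vw2 => <-.
by apply: contraNneq vw1 => ->.
Qed.

(** Let [b] be a second common neighbour of [v] and [w]. If [b = u'], then [uu'] is a chord of the
    cycle [u v u' w]; otherwise [vu] is a chord of the cycle [v u' u w b]. *)
Lemma shared_unmatched u w u' : w \notin N -> w != v -> 1 < codegree v w ->
  u \in N -> adj w u -> u' \in N -> adj u u' -> False.
Proof.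
rewrite !inE => vw wv cw vu wu vu' uu'.
have [b] := exists_in_neq u cw; rewrite !inE => /andP[vb wb] bu.
have [E|bu'] := eqVneq b u'.
  rewrite E in wb; apply: (@chord4 u u' v w) => //; rewrite 1?adj_sym //.
  by rewrite eq_sym.
apply: (@chord5 v u u' b w) => //; first [by rewrite eq_sym | by rewrite adj_sym | idtac].
by apply: contraNneq vw => <-.
Qed.

(** Both sides count the walks of length 2 from [v]; those that return to [v] give the term
    [degree v]. *)
Lemma sum_degree_neighbors :
  \sum_(u in N) degree u =
    degree v + \sum_(w in N) codegree v w + \sum_(w in R) codegree v w.
Proof.
transitivity (\sum_(w in [set: G]) codegree v w).
  by rewrite sum_codegree; apply: eq_bigr => u _; rewrite setIT.
rewrite (bigID (mem (v |: N))) /=; congr (_ + _); last first.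
  by apply: eq_bigl => w; rewrite !inE.
rewrite (eq_bigl (mem (v |: N))); last by move=> w; rewrite inE.
by rewrite big_setU1 /= ?inE ?adj_irr // /codegree setIid.
Qed.

(* Each neighbour of [v] has at most one neighbour in [N :|: B], so the
   codegrees over [N :|: B] sum to at most [degree v]; every other vertex
   contributes at most 2. *)
Lemma sum_degree_neighbors_le :
  1 < #|G| -> degree v < #|G| - 1 -> \sum_(u in N) degree u <= 2 * (#|G| - 2).
Proof.
move=> G2 dv; rewrite sum_degree_neighbors.
have cR := card_nonneighbors; have dN : #|N| = degree v by [].
have subB : B \subset R by apply/subsetP => w; rewrite inE => /andP[].
have NBle : \sum_(w in N) codegree v w + \sum_(w in B) codegree v w <= degree v.
  have <- : \sum_(w in N :|: B) codegree v w =
      \sum_(w in N) codegree v w + \sum_(w in B) codegree v w.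
    rewrite (big_setID N) /=; congr (_ + _); apply: eq_bigl => w; rewrite !inE.
      by case: (adj v w); rewrite ?andbF.
    by case: (adj v w); rewrite ?orbT.
  rewrite sum_codegree -dN -sum1_card; apply: leq_sum => u.
  exact: card_neighbors_in_neighborhood_le1.
have RB : \sum_(w in R :\: B) codegree v w <= 2 * #|R :\: B|.
  rewrite mulnC -sum_nat_const; apply: leq_sum => w; rewrite inE => /andP[].
  by rewrite inE => + wR; rewrite wR /= -leqNgt.
have splitR : \sum_(w in R) codegree v w =
    \sum_(w in B) codegree v w + \sum_(w in R :\: B) codegree v w.
  by rewrite (big_setID B) /= (setIidPr subB).
(* The bounds so far give at most [2 * degree v + 2 * #|R :\: B|], which is
   [2 * (#|G| - 1) - 2 * #|B|]. Only an empty [B] leaves a deficit of 2 to recover. *)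
have cRB := cardsDS subB; have [B0|] := posnP #|B|; last by lia.
have {}B0 : B = set0 by apply/eqP; rewrite -cards_eq0 B0.
rewrite B0 big_set0 setD0 in NBle RB splitR.
(* By [shared_unmatched] the common neighbours of [v] and such a [w] have no neighbour in [N]. At
   least two terms of the sum over [N] thus vanish, which recovers the deficit. *)
have [/existsP[w /andP[wR cw]]|] := boolP [exists w, (w \in R) && (1 < codegree v w)].
  suff : \sum_(w in N) codegree v w + codegree v w <= degree v by lia.
  rewrite sum_codegree (bigID (mem (neighbors w))) /= big1; last first.
    move=> u /andP[uN uw]; apply/eqP; rewrite cards_eq0; apply/eqP/setP => u'.
    rewrite !inE; apply/negP => /andP[uu' vu'].
    move: wR; rewrite !inE negb_or => /andP[wv vw].
    by apply: (@shared_unmatched u w u'); rewrite ?inE // in uN uw *.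
  rewrite add0n /codegree -dN -(cardsID (neighbors w) N) addnC leq_add2l.
  rewrite -sum1_card (eq_bigl (mem (N :\: neighbors w))); last first.
    by move=> u; rewrite !inE andbC.
  apply: leq_sum => u /=; rewrite in_setD => /andP[_ uN].
  apply: leq_trans (card_neighbors_in_neighborhood_le1 uN).
  by apply: subset_leq_card; apply: setIS; exact: subsetUl.
(* Now each vertex of [R] contributes at most 1 instead of 2, so two vertices in [R] suffice. A
   single one would have all its neighbours, at least two, in [N], hence codegree above 1. *)
rewrite negb_exists => /forallP nsh.
have R1 : \sum_(w in R) codegree v w <= #|R|.
  rewrite -sum1_card; apply: leq_sum => w wR; have := nsh w.
  by rewrite wR /= -leqNgt.
suff : 1 < #|R| by lia.
rewrite ltnNge; apply/negP => cR1.
have /card_gt0P[w wR] : 0 < #|R| by lia.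
have := nsh w; rewrite wR /= => /negP[].
apply: leq_trans (min_degree_ge2 w (proj1 minG) G2) _.
apply: subset_leq_card; apply/subsetP => u; rewrite !inE => wu.
rewrite wu andbT; apply: contraT => vu.
have wv : w \notin N by move: wR; rewrite !inE negb_or => /andP[].
have uR : u \in R.
  rewrite !inE negb_or vu andbT; apply: contraNneq wv => <-.
  by rewrite inE adj_sym.
have /card_le1_eqP/(_ u w uR wR) E := cR1.
by rewrite E adj_irr in wu.
Qed.


(** Every vertex other than [v] has exactly one further neighbour: one by minimum degree, no more
    since [N] is everything but [v]. Off [v] the graph is therefore a perfect matching. *)
Lemma dominating_friendship : 2 < #|G| -> degree v = #|G| - 1 ->
  odd #|G| /\ graph_iso G (friendship ((#|G| - 1) %/ 2)).
Proof.
move=> G2 dv.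
have R0 : R = set0 by apply/eqP; rewrite -cards_eq0 card_nonneighbors dv subnn.
have vN u : u != v -> adj v u.
  by move=> uv; have /setP/(_ u) := R0; rewrite !inE (negPf uv) => /negPn.
(* The partner of [u] in the matching; the default is never taken when [u != v], by [ptP]. *)
pose pt u := odflt u [pick u' | (u' != v) && adj u u'].
have ptP u : u != v -> pt u != v /\ adj u (pt u).
  move=> uv; rewrite /pt; case: pickP => [u' /andP[]|/= none] //.
  have [u'] := exists_in_neq v (min_degree_ge2 u (proj1 minG) (ltnW G2)).
  by rewrite inE => uu' u'v; have := none u'; rewrite uu' u'v.
have ptU u u' : u != v -> u' != v -> adj u u' = (u' == pt u).
  move=> uv u'v; have [pv up] := ptP u uv; apply/idP/eqP => [uu'|->] //.
  have uN : u \in N by rewrite inE vN.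
  have /card_le1_eqP := card_neighbors_in_neighborhood_le1 uN; apply; rewrite !inE ?uu' ?up vN //.
have ptK u : u != v -> pt (pt u) = u.
  move=> uv; have [pv up] := ptP u uv; apply/eqP.
  by rewrite eq_sym -ptU // adj_sym.
(* One representative per matched pair, the end of smaller rank; [T] and its image under [pt]
   partition the vertices other than [v]. *)
pose T := [set u | (u != v) && (enum_rank u < enum_rank (pt u))].
have TV : T :|: pt @: T = [set~ v].
  apply/setP => u; rewrite !inE; have [->|uv] /= := eqVneq u v.
    apply/negP => /imsetP[u']; rewrite inE => /andP[u'v _] E.
    by have [] := ptP u' u'v; rewrite -E eqxx.
  have [//|] := ltnP; rewrite leq_eqVlt => /orP[/eqP/ord_inj/enum_rank_inj E|lt].
    by have [_] := ptP u uv; rewrite E adj_irr.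
  apply/imsetP; exists (pt u); last by rewrite ptK.
  by rewrite inE ptK // lt andbT; have [] := ptP u uv.
have TI : T :&: pt @: T = set0.
  apply/setP => u; rewrite !inE; apply/negP => /andP[/andP[uv lt] /imsetP[u']].
  rewrite inE => /andP[u'v lt'] E; rewrite {u uv}E in lt *.
  by rewrite ptK // ltnNge ltnW in lt.
have cT : #|G| - 1 = #|T|.*2.
  have := cardsUI T (pt @: T); rewrite TV TI cards0 addn0 cardsC1 subn1 => ->.
  rewrite card_in_imset ?addnn // => x y; rewrite !inE => /andP[xv _] /andP[yv _] E.
  by rewrite -(ptK x xv) E ptK.
have Tk : #|T| = (#|G| - 1) %/ 2 by lia.
split; first by lia.
pose t (i : 'I_((#|G| - 1) %/ 2)) : G := enum_val (cast_ord (esym Tk) i).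
have tT i : (t i != v) && (enum_rank (t i) < enum_rank (pt (t i))).
  by have := enum_valP (cast_ord (esym Tk) i); rewrite inE.
have tv i : t i != v by case/andP: (tT i).
have tI : injective t by move=> i j /enum_val_inj /cast_ord_inj.
have ptv i : pt (t i) != v by case: (ptP _ (tv i)).
have tpt i j : (t i == pt (t j)) = false.
  apply/negP => /eqP E; have /andP[_ lt1] := tT i; have /andP[_] := tT j.
  by rewrite E ptK // in lt1; rewrite ltnNge ltnW.
have ptt i j : (pt (t i) == pt (t j)) = (i == j).
  apply/eqP/eqP => [E|->] //; apply: tI.
  by rewrite -(ptK _ (tv i)) E ptK.
pose g (x : friendship ((#|G| - 1) %/ 2)) : G :=
  if x is Some (i, b) then if b then pt (t i) else t i else v.
have gI : injective g.
  case=> [[i [|]]|] [[j [|]]|] //= /eqP.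
  - by rewrite ptt => /eqP->.
  - by rewrite eq_sym tpt.
  - by rewrite (negPf (ptv _)).
  - by rewrite tpt.
  - by move/eqP/tI->.
  - by rewrite (negPf (tv _)).
  - by rewrite eq_sym (negPf (ptv _)).
  - by rewrite eq_sym (negPf (tv _)).
have gadj p q : adj (g p) (g q) = friendship_adj p q.
  case: p q => [[i [|]]|] [[j [|]]|] //=; rewrite ?adj_irr ?andbT ?andbF //.
  - by rewrite ptU // ptK // eq_sym tpt.
  - by rewrite ptU // ptK // eq_sym (inj_eq tI).
  - by rewrite adj_sym vN.
  - by rewrite ptU // ptt eq_sym.
  - by rewrite ptU // tpt.
  - by rewrite adj_sym vN.
  - by rewrite vN.
  - by rewrite vN.
have [f fK gK] : bijective g.
  apply: inj_card_bij gI _; rewrite card_option card_prod card_ord card_bool; lia.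
exists f => [|x y]; first by exists g.
by have := gadj (f x) (f y); rewrite !gK.
Qed.

(** The vertex [w] is the only non-neighbour of [v]. All its neighbours, at least two, are shared
    with [v], so [shared_unmatched] leaves them only [v] and [w]. Any other neighbour of [v] has
    exactly one further neighbour, which closes a triangle at [v]. *)
Lemma near_dominating : 2 < #|G| -> degree v = #|G| - 2 ->
  exists w, [/\ w != v, N = ~: [set v; w], neighbors w \subset N,
    {in neighbors w, forall u, neighbors u = [set v; w]} &
    {in N :\: neighbors w, forall u, exists2 u', u' \in N & neighbors u = [set v; u']}].
Proof.
move=> G2 dv; have con2 := proj1 minG; have G1 := ltnW G2.
have cR1 : #|R| = 1 by rewrite card_nonneighbors dv; lia.
have /cards1P[w Rw] : #|R| == 1 by rewrite cR1.
have NE : N = ~: [set v; w].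
  apply/setP => u; have /setP/(_ u) := Rw; rewrite !inE.
  have [->|uv] /= := eqVneq u v; first by rewrite adj_irr.
  by case: (adj v u) => //= <-.
have /negP wvN : w \notin v |: N by rewrite -in_setC Rw set11.
have wv : w != v by apply/eqP => E; case: wvN; rewrite E setU11.
have wN : w \notin N by apply/negP => E; case: wvN; rewrite setU1r.
have vw : ~~ adj v w by rewrite inE in wN.
have wsub : neighbors w \subset N.
  apply/subsetP => u; rewrite NE !inE => wu; rewrite negb_or.
  by rewrite [u == w]eq_sym (adj_neq wu) andbT; apply: contraTneq wu => ->; rewrite adj_sym.
have cw : 1 < codegree v w.
  by rewrite /codegree (setIidPr wsub); exact: min_degree_ge2.
exists w; split=> // u.
- move=> uw; have uN := subsetP wsub u uw; apply/setP => z; rewrite !inE.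
  rewrite inE in uw; have [->|zv] /= := eqVneq z v.
    by rewrite inE adj_sym in uN.
  have [->|zw] /= := eqVneq z w; first by rewrite adj_sym.
  apply/negP => uz; apply: (@shared_unmatched u w z) => //.
  by rewrite NE !inE negb_or zv.
- rewrite in_setD => /andP[uw uN]; rewrite inE in uw.
  have [u'] := exists_in_neq v (min_degree_ge2 u con2 G1); rewrite inE => uu' u'v.
  have u'N : u' \in N.
    by rewrite NE !inE negb_or u'v; apply: contraNneq uw => <-; rewrite adj_sym.
  exists u' => //; apply/setP => z; rewrite !inE.
  have [->|zv] /= := eqVneq z v; first by rewrite inE adj_sym in uN.
  apply/idP/eqP => [uz|->] //.
  have zN : z \in N.
    by rewrite NE !inE negb_or zv; apply: contraNneq uw => <-; rewrite adj_sym.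
  have /card_le1_eqP := card_neighbors_in_neighborhood_le1 uN.
  by apply; rewrite in_setI in_setU [_ \in neighbors u]inE ?u'N ?zN ?uz ?uu'.
Qed.

Lemma twin_complete_bipartite w : w != v -> N = ~: [set v; w] ->
  neighbors w = N -> {in N, forall u, neighbors u = [set v; w]} ->
  graph_iso G (complete_bipartite 2 (#|G| - 2)).
Proof.
move=> wv NE wN nu.
have cN : #|N| = #|G| - 2 by rewrite NE cardsCs setCK cards2 eq_sym wv.
pose t (i : 'I_(#|G| - 2)) : G := enum_val (cast_ord (esym cN) i).
have tN i : t i \in N by exact: (enum_valP (cast_ord (esym cN) i)).
have tI : injective t by move=> i j /enum_val_inj /cast_ord_inj.
pose h (i : 'I_2) := if i == ord0 then v else w.
have hR i : h i \in [set v; w] by rewrite /h; case: ifP; rewrite !inE eqxx ?orbT.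
have hI : injective h.
  move=> i j; rewrite /h; case: eqP => [->|i0]; case: eqP => [->|j0] // E.
  - by rewrite E eqxx in wv.
  - by rewrite E eqxx in wv.
  - case: i j i0 j0 {E} => [[|[|i]] i2] [[|[|j]] j2] // i0 j0.
    + by case: i0; apply: val_inj.
    + by case: i0; apply: val_inj.
    + by case: j0; apply: val_inj.
    + exact: val_inj.
have ht i j : h i != t j.
  by apply: contraTneq (tN j) => <-; rewrite NE inE negbK.
have hadj i u : adj (h i) u = (u \in N).
  by rewrite /h; case: ifP => _; [rewrite inE | rewrite -wN inE].
pose g (x : complete_bipartite 2 (#|G| - 2)) : G :=
  match x with inl i => h i | inr j => t j end.
have gI : injective g.
  move=> [i|i] [j|j] /= E; rewrite ?(hI _ _ E) ?(tI _ _ E) //.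
    by have := ht i j; rewrite E eqxx.
  by have := ht j i; rewrite E eqxx.
have gadj p q : adj (g p) (g q) = bipartite_adj p q.
  case: p q => [i|i] [j|j] /=.
  - by rewrite hadj NE inE hR.
  - by rewrite hadj tN.
  - by rewrite adj_sym hadj tN.
  - have := tN j; rewrite NE inE -(nu _ (tN i)) inE; exact: negbTE.
have G2 : 2 <= #|G|.
  by rewrite -[2](_ : #|[set v; w]| = 2) ?max_card // cards2 eq_sym wv.
have [f fK gK] : bijective g.
  by apply: inj_card_bij gI _; rewrite card_sum !card_ord subnKC.
exists f => [|x y]; first by exists g.
by have := gadj (f x) (f y); rewrite !gK.
Qed.

End AroundVertex.
End EdgeConnectivity.

Local Open Scope ring_scope.

(** * Spectral tools: test vectors, isomorphism invariance, eigenvalues of the extremal graphs *)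

Section AlphaOperator.
Variables (R : realType) (alpha : R).

(** The action of [alpha_mx] on functions of the vertices, which keeps the enumeration of [G] out of
    later computations. *)
Definition alpha_op (G : sgraph) (z : G -> R) (x : G) : R :=
  alpha * (degree x)%:R * z x + (1 - alpha) * \sum_(y in neighbors x) z y.

Lemma alpha_opE (G : sgraph) (v : 'rV[R]_#|G|) (x : G) :
  (v *m alpha_mx alpha G) 0 (enum_rank x) =
    alpha_op (fun y => v 0 (enum_rank y)) x.
Proof.
rewrite mxE (reindex enum_rank) /=; last by apply: onW_bij; exact: enum_rank_bij.
rewrite /alpha_op mulr_sumr [X in _ + X]big_mkcond /=.
rewrite (bigD1 x) //= [in RHS](bigD1 x) //= inE adj_irr add0r; congr (_ + _).
  by rewrite !mxE !enum_rankK adj_irr eqxx mulr0 addr0 mulr1n mulrC.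
apply: eq_bigr => y yx; rewrite !mxE !enum_rankK inE (inj_eq enum_rank_inj).
rewrite (negPf yx) mulr0n mulr0 add0r adj_sym.
by case: (adj x y); rewrite ?mulr1 ?mulr0 // mulrC.
Qed.

Lemma alpha_eigenvalueP (G : sgraph) (r : R) :
  reflect (exists2 z : G -> R, exists x, z x != 0 &
             forall x, alpha_op z x = r * z x)
    (eigenvalue (alpha_mx alpha G) r).
Proof.
apply: (iffP eigenvalueP) => [[v vA v0]|[z [x0 zx0] zA]].
  exists (fun x => v 0 (enum_rank x)) => [|x]; last by rewrite -alpha_opE vA mxE.
  case/rV0Pn: v0 => i vi; exists (enum_val i); by rewrite enum_valK.
have zE x : (\row_j z (enum_val j)) 0 (enum_rank x) = z x :> R.
  by rewrite mxE enum_rankK.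
exists (\row_j z (enum_val j)); last first.
  by apply: contraNneq zx0 => /rowP/(_ (enum_rank x0)); rewrite zE mxE => ->.
apply/rowP => j; rewrite -[j]enum_valK alpha_opE mxE zE -zA /alpha_op zE.
by congr (_ + _ * _); apply: eq_bigr => y _; rewrite zE.
Qed.

Lemma eigenvalue_le_index (G : sgraph) (z : G -> R) (r : R) (x : G) :
  z x != 0 -> (forall y, alpha_op z y = r * z y) -> r <= alpha_index alpha G.
Proof.
move=> zx zA; have G0 : (0 < #|G|)%N by apply/card_gt0P; exists x.
have [_] := alpha_index_max alpha G0; apply.
by apply/alpha_eigenvalueP; exists z => //; exists x.
Qed.

Lemma alpha_opB (G : sgraph) (c : R) (y z : G -> R) (x : G) :
  alpha_op (fun u => c * y u - z u) x = c * alpha_op y x - alpha_op z x.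
Proof. by rewrite /alpha_op sumrB -mulr_sumr; ring. Qed.

Lemma alpha_op_norm (G : sgraph) (z : G -> R) (x : G) : 0 <= alpha < 1 ->
  `|alpha_op z x| <= alpha_op (fun u => `|z u|) x.
Proof.
case/andP=> a0 a1; apply: le_trans (ler_normD _ _) _; apply: lerD.
  by rewrite normrM ger0_norm // mulr_ge0 ?ler0n.
have a1' : 0 <= 1 - alpha by lra.
by rewrite normrM (ger0_norm a1') ler_wpM2l // ler_norm_sum.
Qed.

(* Collatz-Wielandt: where the ratio [`|z x| / y x] of an eigenvector [z] is
   maximal, equality must hold throughout, and connectedness spreads this. *)
Lemma index_lt (G : sgraph) (y : G -> R) (l : R) (x0 : G) :
  0 <= alpha < 1 -> (forall a b : G, connect (@adj G) a b) ->
  (forall x, 0 < y x) -> (forall x, alpha_op y x <= l * y x) ->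
  alpha_op y x0 < l * y x0 -> alpha_index alpha G < l.
Proof.
move=> a01 con y0 yl x0l; have G0 : (0 < #|G|)%N by apply/card_gt0P; exists x0.
have [/alpha_eigenvalueP[z [x1 zx1] zA] _] := alpha_index_max alpha G0.
set r := alpha_index _ _ in zA *; rewrite ltNge; apply/negP => lr.
have [i _ imax] := arg_maxP (fun x => `|z x| / y x) (isT : xpredT x1).
set M := `|z i| / y i in imax.
have M0 : 0 < M by apply: lt_le_trans (imax x1 isT); rewrite divr_gt0 ?normr_gt0.
(* The slack in the maximal ratio: nonnegative, and zero at [i]. Where it vanishes, [opd] and [opd0]
   force it to vanish at all neighbours. *)
pose d x := M * y x - `|z x|.
have d0 x : 0 <= d x by rewrite subr_ge0 -ler_pdivrMr //; exact: imax.
have di : d i = 0 by rewrite /d /M divfK ?subrr // gt_eqF.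
have normz x : r * `|z x| <= alpha_op (fun u => `|z u|) x.
  apply: le_trans (alpha_op_norm z x a01); rewrite zA normrM.
  by apply: ler_wpM2r => //; exact: ler_norm.
have opd x : d x = 0 -> alpha_op d x = (1 - alpha) * \sum_(u in neighbors x) d u.
  by move=> dx; rewrite /alpha_op dx mulr0 add0r.
have opd0 x : d x = 0 -> alpha_op d x <= M * (alpha_op y x - l * y x).
  move=> dx; rewrite alpha_opB mulrBr lerB //; apply: le_trans (normz x).
  have <- : M * y x = `|z x| by apply/eqP; rewrite -subr_eq0 -/(d x) dx.
  by rewrite mulrCA; apply: ler_wpM2r => //; rewrite mulr_ge0 // ltW.
have a1 : 0 < 1 - alpha by case/andP: a01; rewrite subr_gt0.
have sumd x : 0 <= \sum_(u in neighbors x) d u by apply: sumr_ge0.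
have step x u : adj x u -> d x = 0 -> d u = 0.
  move=> xu dx; have := opd0 x dx; rewrite opd // => le0.
  have s0 : \sum_(u in neighbors x) d u = 0.
    apply/eqP; rewrite eq_le sumd andbT -(pmulr_rle0 _ a1); apply: le_trans le0 _.
    by rewrite pmulr_rle0 // subr_le0.
  apply/eqP; rewrite eq_le d0 andbT -s0 (bigD1 u) ?inE //= lerDl.
  exact: sumr_ge0.
have walk p x : d x = 0 -> path (@adj G) x p -> d (last x p) = 0.
  by elim: p x => //= u p IH x dx /andP[xu]; apply: IH; exact: step dx.
have /connectP[p pth E] := con i x0.
have dx0 : d x0 = 0 by rewrite E; exact: walk.
have : 0 <= M * (alpha_op y x0 - l * y x0).
  by apply: le_trans (opd0 x0 dx0); rewrite opd // mulr_ge0 // ltW.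
by rewrite pmulr_rge0 // subr_ge0 leNgt x0l.
Qed.

Lemma degree_iso (G H : sgraph) (f : G -> H) (x : G) : bijective f ->
  (forall x y, adj (f x) (f y) = adj x y) -> degree (f x) = degree x.
Proof.
move=> fbij fadj; rewrite /degree -!sum1dep_card (reindex f) /=; last exact: onW_bij.
by apply: eq_bigl => y; rewrite fadj.
Qed.

Lemma index_iso_le (G H : sgraph) : (0 < #|H|)%N -> graph_iso G H ->
  alpha_index alpha H <= alpha_index alpha G.
Proof.
move=> H0 [f fbij fadj].
have [/alpha_eigenvalueP[z [y zy] zA] _] := alpha_index_max alpha H0.
have [g fK gK] := fbij.
apply: (@eigenvalue_le_index G (z \o f) _ (g y)) => [|x]; first by rewrite /= gK.
rewrite /= -zA /alpha_op (degree_iso _ fbij fadj) /=; congr (_ + _ * _).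
rewrite [RHS](reindex f) /=; last exact: onW_bij.
by apply: eq_bigl => u; rewrite !inE fadj.
Qed.

Lemma graph_iso_sym (G H : sgraph) : graph_iso G H -> graph_iso H G.
Proof.
case=> f [g fK gK] fadj; exists g => [|x y]; first by exists f.
by rewrite -fadj !gK.
Qed.

Lemma index_iso (G H : sgraph) : (0 < #|G|)%N -> graph_iso G H ->
  alpha_index alpha G = alpha_index alpha H.
Proof.
move=> G0 GH; have H0 : (0 < #|H|)%N by case: GH => f /bij_eq_card <-.
apply/le_anti; rewrite !index_iso_le //; exact: graph_iso_sym.
Qed.

Lemma alpha_op_const (G : sgraph) (z : G -> R) (c : R) (x : G) :
  {in neighbors x, forall y, z y = c} ->
  alpha_op z x = (degree x)%:R * (alpha * z x + (1 - alpha) * c).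
Proof.
move=> zc; rewrite /alpha_op (eq_bigr (fun=> c)) // sumr_const -mulr_natl.
by rewrite -[#|_|]/(degree x); ring.
Qed.

Lemma alpha_op_pair (G : sgraph) (z : G -> R) (x a b : G) :
  a != b -> neighbors x = [set a; b] ->
  alpha_op z x = 2 * alpha * z x + (1 - alpha) * (z a + z b).
Proof.
move=> ab xN; rewrite /alpha_op -[degree x]/#|neighbors x| xN cards2 ab.
by rewrite big_setU1 ?inE //= big_set1 mulrC; ring.
Qed.

(** The quadratic is the characteristic equation of the 2 by 2 quotient on the centre and the outer
    vertices; [z] lifts the quotient eigenvector. *)
Lemma friendship_index_ge (k : nat) (l : R) : alpha < 1 ->
  (l - alpha * (2 * k)%:R) * (l - 1 - alpha) = (1 - alpha) ^+ 2 * (2 * k)%:R ->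
  (0 < k)%N -> l <= alpha_index alpha (friendship k).
Proof.
move=> a1 lP; case: k lP => // k lP _.
pose z (x : friendship k.+1) : R := if x is Some _ then 1 - alpha else l - 1 - alpha.
apply: (@eigenvalue_le_index _ z _ (Some (ord0, true))) => /=.
  by rewrite gt_eqF // subr_gt0.
case=> [[i b]|].
  rewrite (@alpha_op_pair _ z _ (None : friendship k.+1) (Some (i, ~~ b))) //=.
    by rewrite /z; ring.
  apply/setP => -[[j c]|]; rewrite !inE //= -[Some _ == Some _]/((j, c) == (i, ~~ b)).
  by rewrite xpair_eqE eq_sym; case: b; case: c.
rewrite (@alpha_op_const _ z (1 - alpha)); last by case=> //; rewrite inE.
have -> : degree (None : friendship k.+1) = (2 * k.+1)%N.
  have := cardC1 (None : friendship k.+1).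
  rewrite card_option card_prod card_ord card_bool /= mulnC => <-.
  by apply: eq_card => -[p|]; rewrite !inE.
move: lP; set K := (_ %:R); rewrite /z => lP.
transitivity (alpha * K * (l - 1 - alpha) + (1 - alpha) ^+ 2 * K); first by ring.
by rewrite -lP; ring.
Qed.

(** Likewise for the quotient on the two sides of the bipartition. *)
Lemma complete_bipartite_index_ge (b : nat) (l : R) : alpha < 1 ->
  (l - alpha * b%:R) * (l - 2 * alpha) = 2 * (1 - alpha) ^+ 2 * b%:R ->
  (0 < b)%N -> l <= alpha_index alpha (complete_bipartite 2 b).
Proof.
move=> a1 lP; case: b lP => // b lP _.
pose z (x : complete_bipartite 2 b.+1) : R :=
  if x is inl _ then l - 2 * alpha else 2 * (1 - alpha).
apply: (@eigenvalue_le_index _ z _ (inr ord0)) => /=.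
  by rewrite gt_eqF // mulr_gt0 // subr_gt0.
case=> [i|j].
  rewrite (@alpha_op_const _ z (2 * (1 - alpha))); last by case=> // j; rewrite inE.
  have -> : degree (inl i : complete_bipartite 2 b.+1) = b.+1.
    have inrI : injective (@inr 'I_2 'I_b.+1) by move=> ? ? [].
    rewrite -[RHS]card_ord -(card_imset _ inrI); apply: eq_card => -[k|k]; rewrite !inE /=.
      by apply/esym/imsetP => -[].
    by apply/esym/imsetP; exists k.
  move: lP; set K := (_ %:R); rewrite /z => lP.
  transitivity (alpha * K * (l - 2 * alpha) + 2 * (1 - alpha) ^+ 2 * K); first by ring.
  by rewrite -lP; ring.
rewrite (@alpha_op_pair _ z _ (inl ord0) (inl ord_max)) //=; first by rewrite /z; ring.
apply/setP => -[k|k]; rewrite !inE //=.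
by case: k => [[|[|k]] k2].
Qed.

(** The root produced is the larger one. Lower bounds on it then follow from evaluating the
    quadratic at a point, without handling square roots. *)
Lemma quadratic_top_root (p q c0 : R) : c0 ^+ 2 - p * c0 + q <= 0 ->
  exists2 l, l ^+ 2 - p * l + q = 0 &
    forall c, c ^+ 2 - p * c + q <= 0 -> c <= l.
Proof.
move=> c0P; pose D := p ^+ 2 - 4 * q.
have DE c : (2 * c - p) ^+ 2 = D + 4 * (c ^+ 2 - p * c + q) by rewrite /D; ring.
have D0 : 0 <= D by have := sqr_ge0 (2 * c0 - p); rewrite DE; lra.
exists ((p + Num.sqrt D) / 2) => [|c cP].
  have := sqr_sqrtr D0; rewrite {2}/D; set s := Num.sqrt D => sE.
  suff : 4 * (((p + s) / 2) ^+ 2 - p * ((p + s) / 2) + q) = 0 by lra.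
  transitivity (s ^+ 2 - (p ^+ 2 - 4 * q)); first by field.
  by rewrite sE subrr.
suff : 2 * c - p <= Num.sqrt D by lra.
apply: le_trans (ler_norm _) _; rewrite -sqrtr_sqr ler_wsqrtr // DE; lra.
Qed.

End AlphaOperator.

(** * Comparison of the index of [G] with the extremal eigenvalue *)

Section Comparison.
Variables (R : realType) (alpha : R).
Hypotheses (alpha_ge : 1 / 2 <= alpha) (alpha_lt : alpha < 1).

Lemma friendship_root (K : R) : 6 <= K -> exists2 l,
  (l - alpha * K) * (l - 1 - alpha) = (1 - alpha) ^+ 2 * K &
  alpha * (K - 1) + 2 * (1 - alpha) < l.
Proof.
move=> K6; pose p := alpha * K + 1 + alpha.
pose q := alpha * K * (1 + alpha) - (1 - alpha) ^+ 2 * K.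
have E t : t ^+ 2 - p * t + q =
    (t - alpha * K) * (t - 1 - alpha) - (1 - alpha) ^+ 2 * K by rewrite /p /q; ring.
(* With [K = #|G| - 1] this is the threshold in [index_lt_friendship]. *)
pose c := alpha * (K - 1) + 2 * (1 - alpha).
have cP : c ^+ 2 - p * c + q < 0.
  have -> : c ^+ 2 - p * c + q =
      - (K - 6) * (2 * alpha - 1) ^+ 2 - (12 * alpha ^+ 2 - 13 * alpha + 4).
    by rewrite /c /p /q; ring.
  have : 0 <= (K - 6) * (2 * alpha - 1) ^+ 2 by rewrite mulr_ge0 ?sqr_ge0 // subr_ge0.
  (* 13/24 minimises [12 * alpha ^+ 2 - 13 * alpha + 4], whose minimum is positive. *)
  by have := sqr_ge0 (alpha - 13 / 24); lra.
have [l lP lmax] := quadratic_top_root (ltW cP).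
exists l; first by apply/eqP; rewrite -subr_eq0 -E lP.
rewrite -/c lt_neqAle lmax ?(ltW cP) // andbT.
by apply: contraTneq cP => ->; rewrite lP ltxx.
Qed.

Lemma complete_bipartite_root (M : R) : 6 <= M -> exists l,
  [/\ (l - alpha * M) * (l - 2 * alpha) = 2 * (1 - alpha) ^+ 2 * M,
      (M + 2) / 2 <= l & alpha * (M - 1) + 12 / 5 * (1 - alpha) < l].
Proof.
have a_ge := alpha_ge; move=> M6; pose p := alpha * (M + 2); pose q := 2 * M * (2 * alpha - 1).
have E t : t ^+ 2 - p * t + q =
    (t - alpha * M) * (t - 2 * alpha) - 2 * (1 - alpha) ^+ 2 * M.
  by rewrite /p /q; ring.
pose c := alpha * (M - 1) + 12 / 5 * (1 - alpha).
have cP : c ^+ 2 - p * c + q < 0.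
  have -> : c ^+ 2 - p * c + q =
      - (M - 6) * (27 / 5 * alpha ^+ 2 - 32 / 5 * alpha + 2)
      - (351 / 25 * alpha ^+ 2 - 432 / 25 * alpha + 156 / 25).
    by rewrite /c /p /q; field.
  (* The two quadratics in [alpha] are positive, with minimisers 16/27 and 8/13. *)
  have : 0 <= (M - 6) * (27 / 5 * alpha ^+ 2 - 32 / 5 * alpha + 2).
    by rewrite mulr_ge0 ?subr_ge0 //; have := sqr_ge0 (alpha - 16 / 27); lra.
  by have := sqr_ge0 (alpha - 8 / 13); lra.
have hP : ((M + 2) / 2) ^+ 2 - p * ((M + 2) / 2) + q <= 0.
  have -> : ((M + 2) / 2) ^+ 2 - p * ((M + 2) / 2) + q =
      - ((2 * alpha - 1) * (M - 2) ^+ 2 / 4) by rewrite /p /q; field.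
  have : 0 <= (2 * alpha - 1) * (M - 2) ^+ 2.
    by apply: mulr_ge0; [lra | exact: sqr_ge0].
  lra.
have [l lP lmax] := quadratic_top_root hP.
exists l; split; [by apply/eqP; rewrite -subr_eq0 -E lP | exact: lmax |].
rewrite -/c lt_neqAle lmax ?(ltW cP) // andbT.
by apply: contraTneq cP => ->; rewrite lP ltxx.
Qed.

Variable G : sgraph.
Hypothesis minG : minimally_edge_connected 2 G.
Implicit Types x u v w : G.

Let alpha01 : 0 <= alpha < 1.
Proof. by rewrite alpha_lt andbT (le_trans _ alpha_ge) // divr_ge0. Qed.

Let conG a b : connect (@adj G) a b.
Proof. exact: two_edge_connected_connect (proj1 minG). Qed.

Lemma degree_le x : (degree x <= #|G| - 1)%N.
Proof.
rewrite subn1 -(cardC1 x); apply: subset_leq_card; apply/subsetP => y.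
by rewrite !inE eq_sym => /adj_neq.
Qed.

Lemma index_lt_degree (l : R) : (1 < #|G|)%N ->
  (forall x, alpha * (degree x)%:R ^+ 2 +
     (1 - alpha) * (\sum_(u in neighbors x) degree u)%N%:R < l * (degree x)%:R) ->
  alpha_index alpha G < l.
Proof.
move=> G1 lt; have /card_gt0P[x0 _] := ltnW G1.
have op x : alpha_op alpha (fun u => (degree u)%:R) x < l * (degree x)%:R.
  by apply: le_lt_trans (lt x); rewrite /alpha_op natr_sum expr2 mulrA.
apply: (index_lt (x0 := x0) alpha01 conG _ _ (op x0)) => x; last exact: ltW.
by rewrite ltr0n ltnW //; exact: min_degree_ge2 (proj1 minG) G1.
Qed.

Lemma index_lt_friendship (l : R) : (3 < #|G|)%N ->
  (forall x, degree x < #|G| - 1)%N ->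
  alpha * (#|G|%:R - 2) + 2 * (1 - alpha) < l -> alpha_index alpha G < l.
Proof.
have [a_ge a_lt] := conj alpha_ge alpha_lt.
move=> G3 dlt cl; have G1 : (1 < #|G|)%N by lia.
apply: index_lt_degree => // x.
have d2 := min_degree_ge2 x (proj1 minG) G1.
have := sum_degree_neighbors_le minG G1 (dlt x); set S := (\sum_(u in _) _)%N => S2.
have {}S2 : S%:R <= 2 * (#|G|%:R - 2) :> R.
  by rewrite -natrB // -natrM ler_nat.
have dle : (degree x)%:R <= #|G|%:R - 2 :> R.
  by rewrite -natrB // ler_nat; have := dlt x; lia.
have {}d2 : 2 <= (degree x)%:R :> R by rewrite ler_nat.
set d := (_ %:R) in dle d2 *; set m := #|G|%:R - 2 in S2 dle cl.
have h1 : (1 - alpha) * S%:R <= (1 - alpha) * (2 * m) by apply: ler_wpM2l => //; lra.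
have h2 : (alpha * m + 2 * (1 - alpha)) * d < l * d by rewrite ltr_pM2r //; lra.
have ad : alpha * 2 <= alpha * d by apply: ler_wpM2l => //; lra.
(* This product equals [(alpha * m + 2 * (1 - alpha)) * d] minus
   [alpha * d ^+ 2 + 2 * (1 - alpha) * m]; its first factor is nonnegative because [alpha >= 1 / 2]
   and [d >= 2]. *)
have h3 : 0 <= (alpha * d - 2 * (1 - alpha)) * (m - d).
  by apply: mulr_ge0; [lra | lra].
lra.
Qed.

(** For degrees from 3 to n - 3 the second bound on [l] is used: 12/5 is the value of 2 (n - 2) / (n
    - 3) at n = 8, an upper bound for it when n is larger. Degree 2 uses [l >= n / 2], with each of
    the two neighbours of degree at most n - 3. *)
Lemma index_lt_complete_bipartite_small (l : R) : (8 <= #|G|)%N ->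
  (forall x, degree x < #|G| - 2)%N -> #|G|%:R / 2 <= l ->
  alpha * (#|G|%:R - 3) + 12 / 5 * (1 - alpha) < l -> alpha_index alpha G < l.
Proof.
have [a_ge a_lt] := conj alpha_ge alpha_lt.
move=> G8 dlt nl cl; have G1 : (1 < #|G|)%N by lia.
have n8 : 8 <= #|G|%:R :> R by rewrite ler_nat.
set n := #|G|%:R in nl cl n8.
have dle x : (degree x)%:R <= n - 3 :> R.
  by rewrite /n -natrB ?ler_nat; have := dlt x; lia.
apply: index_lt_degree => // x.
have d2 := min_degree_ge2 x (proj1 minG) G1.
have dltx : (degree x < #|G| - 1)%N by have := dlt x; lia.
have := sum_degree_neighbors_le minG G1 dltx.
have : (\sum_(u in neighbors x) degree u <= degree x * (#|G| - 3))%N.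
  rewrite -[degree x]/#|neighbors x| -sum_nat_const; apply: leq_sum => u _.
  by have := dlt u; lia.
set S := (\sum_(u in _) _)%N => Sd S2.
have {}S2 : S%:R <= 2 * (n - 2) :> R by rewrite /n -natrB // -natrM ler_nat.
have := dle x; case: (ltnP 2 (degree x)) => d3 dlex.
  have {}d3 : 3 <= (degree x)%:R :> R by rewrite ler_nat.
  set d := (_ %:R) in dlex d3 *.
  have h1 : (1 - alpha) * S%:R <= (1 - alpha) * (2 * (n - 2)).
    by apply: ler_wpM2l => //; lra.
  have h2 : (alpha * (n - 3) + 12 / 5 * (1 - alpha)) * d < l * d.
    by rewrite ltr_pM2r //; lra.
  have ad : alpha * 3 <= alpha * d by apply: ler_wpM2l => //; lra.
  have h3 : 0 <= (alpha * d - 12 / 5 * (1 - alpha)) * (n - 3 - d).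
    by apply: mulr_ge0; [lra | lra].
  have h4 : 0 <= (1 - alpha) * (n - 8) by apply: mulr_ge0; lra.
  lra.
have dE : degree x = 2%N by apply/eqP; rewrite eqn_leq d3.
rewrite dE in Sd *.
have h1 : (1 - alpha) * S%:R <= (1 - alpha) * (2 * (n - 3)).
  apply: ler_wpM2l; first by lra.
  by rewrite /n -natrB -?natrM ?ler_nat //; lia.
have h2 : 0 <= (2 * alpha - 1) * (n - 8) by apply: mulr_ge0; lra.
lra.
Qed.

(* The test vector is the Perron vector of [complete_bipartite 2 (n - 2)],
   with [v] and its only non-neighbour [w] in the roles of the two hubs. *)
Lemma index_lt_complete_bipartite (l : R) v : (8 <= #|G|)%N ->
  degree v = (#|G| - 2)%N ->
  (l - alpha * (#|G|%:R - 2)) * (l - 2 * alpha) =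
    2 * (1 - alpha) ^+ 2 * (#|G|%:R - 2) ->
  #|G|%:R / 2 <= l ->
  graph_iso G (complete_bipartite 2 (#|G| - 2)) \/ alpha_index alpha G < l.
Proof.
have [a_ge a_lt] := conj alpha_ge alpha_lt.
move=> G8 dv lP nl; have G2 : (2 < #|G|)%N by lia.
have n8 : 8 <= #|G|%:R :> R by rewrite ler_nat.
have [w [wv NE wsub nw nnw]] := near_dominating minG G2 dv.
have [wN|wN] := eqVneq (neighbors w) (neighbors v).
  by left; apply: (twin_complete_bipartite wv NE wN); rewrite -wN.
right; have dw : (degree w < #|G| - 2)%N.
  by rewrite -dv; apply: proper_card; rewrite properEneq wN.
have vw : v != w by rewrite eq_sym.
pose X := l - 2 * alpha; pose Y := 2 * (1 - alpha).
pose y u := if u \in [set v; w] then X else Y.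
have yN u : u \in neighbors v -> y u = Y.
  by rewrite NE /y inE => /negPf->.
have yv : y v = X by rewrite /y set21.
have yw : y w = X by rewrite /y set22.
have l4 : 4 <= l by lra.
have Y0 : 0 < Y by rewrite /Y; lra.
have XY : Y < X by rewrite /X /Y; lra.
have X0 := lt_trans Y0 XY.
have hub : (#|G|%:R - 2) * (alpha * X + (1 - alpha) * Y) = l * X.
  rewrite /X /Y.
  transitivity (alpha * (#|G|%:R - 2) * (l - 2 * alpha) +
    2 * (1 - alpha) ^+ 2 * (#|G|%:R - 2)); first by ring.
  by rewrite -lP; ring.
(* [hub] is the eigenvalue equation at degree n - 2; the smaller degree of [w] makes it strict
   here. *)
have opw : alpha_op alpha y w < l * y w.
  rewrite (@alpha_op_const _ _ _ y Y) => [|u uw]; last by rewrite yN // (subsetP wsub).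
  have dwR : (degree w)%:R < #|G|%:R - 2 :> R by rewrite -natrB ?ltr_nat // ltnW.
  rewrite yw -hub ltr_pM2r //.
  by apply: addr_gt0; apply: mulr_gt0 => //; lra.
have opx x : alpha_op alpha y x <= l * y x.
  have [->|xv] := eqVneq x v.
    rewrite (@alpha_op_const _ _ _ y Y) => [|u]; last exact: yN.
    by rewrite dv yv natrB ?hub ?(ltnW G2).
  have [->|xw] := eqVneq x w; first exact: ltW.
  have xN : x \in neighbors v by rewrite NE !inE negb_or xv.
  have [xnw|xnw] := boolP (x \in neighbors w).
    rewrite (alpha_op_pair _ _ vw (nw x xnw)) yv yw yN //.
    by rewrite /X /Y; lra.
  (* On a triangle at [v] the second neighbour has value [Y], below the hub value [X] that would
     give equality. *)
  have [|u uN xE] := nnw x; first by rewrite inE xnw.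
  have vu : v != u by apply: contraTneq uN => <-; rewrite inE adj_irr.
  rewrite (alpha_op_pair _ _ vu xE) yv !yN //.
  have : (1 - alpha) * Y <= (1 - alpha) * X by rewrite ler_pM2l; lra.
  by rewrite /X /Y; lra.
apply: (index_lt (x0 := w) alpha01 conG _ opx opw) => x.
by rewrite /y; case: ifP.
Qed.

End Comparison.

Theorem theorem1p1 (R : realType) (alpha : R) (n : nat) (G : sgraph)
    (alpha_ge : 1 / 2 <= alpha) (alpha_lt : alpha < 1)
    (orderG : #|G| = n) (minG : minimally_edge_connected 2 G) :
  ((7 <= n)%N -> odd n ->
     alpha_index alpha G <= alpha_index alpha (friendship ((n - 1) %/ 2)) /\
     (alpha_index alpha G = alpha_index alpha (friendship ((n - 1) %/ 2)) <->
      graph_iso G (friendship ((n - 1) %/ 2)))) /\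
  ((8 <= n)%N -> ~~ odd n ->
     alpha_index alpha G <= alpha_index alpha (complete_bipartite 2 (n - 2)) /\
     (alpha_index alpha G = alpha_index alpha (complete_bipartite 2 (n - 2)) <->
      graph_iso G (complete_bipartite 2 (n - 2)))).
Proof.
have conclude (H : sgraph) : (0 < #|G|)%N ->
    graph_iso G H \/ alpha_index alpha G < alpha_index alpha H ->
    alpha_index alpha G <= alpha_index alpha H /\
    (alpha_index alpha G = alpha_index alpha H <-> graph_iso G H).
  move=> G0 [iso|lt]; first by rewrite (index_iso alpha G0 iso).
  split; first exact: ltW.
  by split=> [E|/(index_iso alpha G0) E]; rewrite E ltxx in lt.
rewrite -orderG {n orderG}; split=> n_ge n_par; apply: conclude; try lia.
- have n7 : 7 <= #|G|%:R :> R by rewrite ler_nat.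
  have K6 : 6 <= #|G|%:R - 1 :> R by lra.
  have [l lP lc] := friendship_root alpha K6.
  have [/existsP[v /eqP dv]|] := boolP [exists v : G, degree v == (#|G| - 1)%N].
    by left; apply: (dominating_friendship minG _ dv).2; lia.
  rewrite negb_exists => /forallP nd; right.
  apply: (@lt_le_trans _ _ l).
    apply: (index_lt_friendship alpha_ge alpha_lt minG); first by lia.
      by move=> x; rewrite ltn_neqAle nd degree_le.
    by apply: le_lt_trans lc; lra.
  have E : (2 * ((#|G| - 1) %/ 2) = #|G| - 1)%N by lia.
  by apply: friendship_index_ge => //; [rewrite E natrB //; lia | lia].
- have n8 : 8 <= #|G|%:R :> R by rewrite ler_nat.
  have M6 : 6 <= #|G|%:R - 2 :> R by lra.
  have [l [lP lh lc]] := complete_bipartite_root alpha_ge M6.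
  rewrite subrK in lh.
  have lH : l <= alpha_index alpha (complete_bipartite 2 (#|G| - 2)).
    by apply: complete_bipartite_index_ge => //; [rewrite natrB //; lia | lia].
  have nd1 (x : G) : degree x != (#|G| - 1)%N.
    apply: contraNneq n_par => dx.
    have G2 : (2 < #|G|)%N by lia.
    by have [] := dominating_friendship minG G2 dx.
  have [/existsP[v /eqP dv]|] := boolP [exists v : G, degree v == (#|G| - 2)%N].
    have [|lt] := index_lt_complete_bipartite alpha_ge alpha_lt minG n_ge dv lP lh.
      by left.
    by right; exact: lt_le_trans lH.
  rewrite negb_exists => /forallP nd; right; apply: lt_le_trans lH.
  apply: (index_lt_complete_bipartite_small alpha_ge alpha_lt minG) => // [x|].
    by have := degree_le x; have := nd1 x; have := nd x; lia.
  by apply: le_lt_trans lc; lra.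
Qed.
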